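(* Let $\mathcal{M}_1=(V,\mathcal{I}_1),\dots,\mathcal{M}_k=(V,\mathcal{I}_k)$ be $k$ matroids on a common ground set $V$ with $|V|=n$, each accessible only through an independence oracle, and let $p$ be the maximum cardinality of a partitionable set. For any $\epsilon>0$, there is an algorithm that uses $O\big((kn+p\log p)\epsilon^{-1}\big)$ independence oracle queries and finds a partitionable set of cardinality at least $(1-\epsilon)p$.
   Context: A set $S\subseteq V$ is partitionable if there is a partition $(S_1,\dots,S_k)$ of $S$ with $S_i\in\mathcal{I}_i$ for all $i\in[k]$. An independence oracle for $\mathcal{M}_i$ takes $X\subseteq V$ and answers whether $X\in\mathcal{I}_i$; the query complexity counts the total number of oracle calls over all $k$ matroids. *)

(* Defs.v *)
From HB Require Import structures.
From mathcomp Require Import all_boot all_order all_algebra.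
From mathcomp Require Import reals exp.

Set Implicit Arguments.
Unset Strict Implicit.
Unset Printing Implicit Defensive.

Record matroid (V : finType) := Matroid {
  indep : {set V} -> bool;
  indep0 : indep set0;
  indepS : forall X Y : {set V}, X \subset Y -> indep Y -> indep X;
  indep_augment : forall X Y : {set V},
    indep X -> indep Y -> #|X| < #|Y| ->
    exists2 y, y \in Y :\: X & indep (y |: X)
}.

(* The parts are indexed by the matroids and may be empty, so this is not
   [finset.partition], whose blocks are nonempty. *)
Definition partitionable (V : finType) (k : nat) (M : 'I_k -> matroid V)
    (S : {set V}) : bool :=
  [exists P : {ffun 'I_k -> {set V}},
    [&& [forall i, forall j, (i != j) ==> [disjoint P i & P j]],
        \bigcup_i P i == S
      & [forall i, indep (M i) (P i)]]].

Definition max_partitionable (V : finType) (k : nat)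
    (M : 'I_k -> matroid V) : nat :=
  \max_(S : {set V} | partitionable M S) #|S|.

(* Deterministic adaptive oracle algorithms, as decision trees: [Query i X c]
   asks whether [X] is independent in the [i]-th matroid and continues with [c]
   applied to the answer.  The matroids are not an input of the tree, so they
   are accessible only through the answers; computation between two queries is
   free, as usual for query complexity. *)
Inductive oracle_alg (V : finType) (k : nat) (T : Type) : Type :=
  | Return of T
  | Query of 'I_k & {set V} & (bool -> oracle_alg V k T).

Fixpoint output (V : finType) (k : nat) (T : Type) (A : oracle_alg V k T)
    (M : 'I_k -> matroid V) : T :=
  match A with
  | Return t => t
  | Query i X c => output (c (indep (M i) X)) M
  end.

(* Repeated queries count each time. *)
Fixpoint num_queries (V : finType) (k : nat) (T : Type) (A : oracle_alg V k T)
    (M : 'I_k -> matroid V) : nat :=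
  match A with
  | Return _ => 0
  | Query i X c => (num_queries (c (indep (M i) X)) M).+1
  end.

(* Main.v *)
Require Import Defs.
From HB Require Import structures.
From mathcomp Require Import all_boot all_order all_algebra.
From mathcomp Require Import reals exp.
From mathcomp Require Import zify ring lra.

(* A push-relabel algorithm.  Every element [v] has a level, at most [D] (of
   order [1 / eps]), and scans the matroids one after the other.  An element
   [v] at level [t] that belongs to no block asks whether the elements of level
   at least [t] of the current block span it.  If they do, it passes to the
   next matroid, and after the last one its level increases.  Otherwise it is
   inserted when [t = 0]; when [t > 0], it replaces an element of level [t - 1]
   of its fundamental circuit, found by binary search.  The spans of the sets
   "elements of level at least [t] of the [i]-th block" never shrink, so a
   positive answer remains valid, and there are at most [n k D] of them.  Each
   insertion or swap increases the sum of [level + 1] over the covered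
   elements, which is at most [p D], and costs [O(log p)] queries.  At the end,
   for every [t < D] the spanning relations bound [p] by the number of covered
   elements plus the number of those of level [t]; averaging over [t] gives the
   approximation ratio. *)

Set Implicit Arguments.
Unset Strict Implicit.
Unset Printing Implicit Defensive.

Import Order.TTheory GRing.Theory Num.Theory.

(** * Exchange and span in a single matroid *)

Section Matroid.
Variables (V : finType) (m : matroid V).
Implicit Types (B J X Y Z : {set V}) (u v w : V).

(** A largest independent set between [Y] and [Y :|: B] works: if it were smaller than [B], it could
    be augmented from [B]. *)
Lemma indep_extend Y B : indep m Y -> indep m B ->
  exists Z, [/\ Y \subset Z, Z \subset Y :|: B, indep m Z & #|B| <= #|Z|].
Proof.
move=> iY iB; pose P Z := [&& Y \subset Z, Z \subset Y :|: B & indep m Z].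
have PY : P Y by rewrite /P subxx subsetUl.
case: (arg_maxnP (fun Z : {set V} => #|Z|) PY) => Z /and3P[YZ ZYB iZ] maxZ.
exists Z; split=> //; rewrite leqNgt; apply/negP => ltZB.
have [y /setDP[yB yZ] iyZ] := indep_augment iZ iB ltZB.
have PyZ : P (y |: Z).
  apply/and3P; split=> //; first exact: subset_trans (subsetUr _ _).
  by rewrite subUset sub1set inE yB orbT.
by have := maxZ _ PyZ; rewrite /= cardsU1 yZ; lia.
Qed.

(* [u] lies in the fundamental circuit of [v] over [B], since that circuit is
   contained in [u |: Y] but not in [Y]. *)
Lemma indep_exchange B Y u v : indep m B -> v \notin B -> u \in B ->
  indep m Y -> v \in Y -> Y \subset v |: B -> ~~ indep m (u |: Y) ->
  indep m (v |: B :\ u).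
Proof.
move=> iB vB uB iY vY YvB duY; have [Z [YZ ZYB iZ leBZ]] := indep_extend iY iB.
have uZ : u \notin Z.
  by apply: contra duY => uZ; apply: indepS iZ; rewrite subUset sub1set uZ.
have ZvBu : Z \subset v |: B :\ u.
  apply/subsetP => z zZ; have zu : z != u by apply: contraNneq uZ => <-.
  have := subsetP ZYB z zZ; rewrite !inE zu /=.
  by case/orP => [/(subsetP YvB)|->]; rewrite ?inE ?orbT.
(* [Z] avoids [u] and has at least [#|B|] elements, so it exhausts [v |: B :\ u]. *)
suff /eqP <- : Z == v |: B :\ u by [].
rewrite eqEcard ZvBu (leq_trans _ leBZ) // cardsU1 [#|B|](cardsD1 u) uB.
by rewrite leq_add2r leq_b1.
Qed.

Definition spanned J v := (v \in J) || ~~ indep m (v |: J).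

Lemma spannedS J J' v : J \subset J' -> spanned J v -> spanned J' v.
Proof.
move=> sJ; case/orP => [vJ|dv]; apply/orP; first by left; exact: (subsetP sJ).
by right; apply: contra dv; apply: indepS; exact: setUS.
Qed.

(** The new set has the size of [J]. If adding [v] kept it independent, augmenting [J] from the
    result would add [w] or [v], both spanned by [J]. *)
Lemma spanned_exchange J u w v : indep m J -> u \in J -> ~~ indep m (w |: J) ->
  spanned J v -> spanned (w |: J :\ u) v.
Proof.
move=> iJ uJ dwJ; rewrite /spanned; set J' := w |: J :\ u.
have wJ : w \notin J by apply: contra dwJ => wJ; rewrite (setUidPr _) ?sub1set.
have cJ' : #|J'| = #|J|
  by rewrite cardsU1 !inE (negPf wJ) andbF [RHS](cardsD1 u) uJ.
case: (boolP (v \in J')) => //= vJ' sv; apply/negP => ivJ'.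
have [y /setDP[yvJ' yJ] iy] :
    exists2 y, y \in (v |: J') :\: J & indep m (y |: J).
  by apply: indep_augment => //; rewrite cardsU1 vJ' cJ'.
have yw : y != w by apply: contraTneq iy => ->.
move: yvJ'; rewrite !inE (negPf yw) (negPf yJ) andbF !orbF => /eqP yv.
by move: sv; rewrite -yv (negPf yJ) iy.
Qed.

Lemma indep_spanned_leq J T : indep m J -> indep m T ->
  {in T, forall v, spanned J v} -> #|T| <= #|J|.
Proof.
move=> iJ iT sT; rewrite leqNgt; apply/negP => /(indep_augment iJ iT).
by case=> y /setDP[/sT/orP[->//|/negPf->]].
Qed.

End Matroid.

(** * Sequencing of oracle algorithms and binary search *)

Section Oracle.
Variables (V : finType) (k : nat).

Fixpoint bind (T U : Type) (A : oracle_alg V k T) (f : T -> oracle_alg V k U) :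
    oracle_alg V k U :=
  match A with
  | Return t => f t
  | Query i X c => Query i X (fun b => bind (c b) f)
  end.

Lemma output_bind T U (A : oracle_alg V k T) (f : T -> oracle_alg V k U) M :
  output (bind A f) M = output (f (output A M)) M.
Proof. by elim: A => //= i X c IH; rewrite IH. Qed.

Lemma num_queries_bind T U (A : oracle_alg V k T)
    (f : T -> oracle_alg V k U) M :
  num_queries (bind A f) M =
  (num_queries A M + num_queries (f (output A M)) M)%N.
Proof. by elim: A => //= i X c IH; rewrite IH. Qed.

(** Invariant: [X] is independent, [X] together with [s] is not. [e] counts the halvings left, and
    [x0] is only a default for [head]. *)
Fixpoint bsearch (x0 : V) (i : 'I_k) (e : nat) (X : {set V}) (s : seq V) :
    oracle_alg V k V :=
  if e is e'.+1 then
    let X' := X :|: [set x in take (2 ^ e') s] in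
    Query i X' (fun b => if b then bsearch x0 i e' X' (drop (2 ^ e') s)
                         else bsearch x0 i e' X (take (2 ^ e') s))
  else Return V k (head x0 s).

Lemma num_queries_bsearch x0 i e X s M :
  num_queries (bsearch x0 i e X s) M = e.
Proof. by elim: e X s => //= e IH X s; case: ifP; rewrite IH. Qed.

(** [Y] is the set [X] accumulated at the last call; it is the certificate that [indep_exchange]
    requires. *)
Lemma output_bsearch x0 i e X s M : size s <= 2 ^ e ->
    indep (M i) X -> ~~ indep (M i) (X :|: [set x in s]) ->
  let u := output (bsearch x0 i e X s) M in
  u \in s /\ exists Y : {set V}, [/\ X \subset Y, Y \subset X :|: [set x in s],
                           indep (M i) Y & ~~ indep (M i) (u |: Y)].
Proof.
elim: e X s => [|e IH] X s /= les iX ds.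
  (* At most one candidate is left, and at least one since [X] alone is independent. *)
  case: s les ds => [|u [|//]] _ /= ds.
    suff E : X :|: [set x in [::]] = X by rewrite E iX in ds.
    by apply/setP => x; rewrite !inE orbF.
  split; first exact: mem_head.
  exists X; split=> //; first exact: subsetUl.
  suff <- : X :|: [set x in [:: u]] = u |: X by [].
  by apply/setP => x; rewrite !inE orbC.
have E : X :|: [set x in s] =
    X :|: [set x in take (2 ^ e) s] :|: [set x in drop (2 ^ e) s].
  by apply/setP => x; rewrite !inE -{1}(cat_take_drop (2 ^ e) s) mem_cat orbA.
case: ifP => iX'.
  have [||us [Y [XY YX iY dY]]] := IH _ (drop (2 ^ e) s) _ iX'.
  - by rewrite size_drop leq_subLR addnn -mul2n -expnS.
  - by rewrite -E.
  split; first exact: mem_drop us.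
  exists Y; split=> //; last by rewrite E.
  exact: subset_trans (subsetUl _ _) XY.
have [|us [Y [XY YX iY dY]]] := IH X (take (2 ^ e) s) _ iX (negbT iX').
  by rewrite size_take_min geq_minl.
split; first exact: mem_take us.
exists Y; split=> //; apply: subset_trans YX _.
by rewrite E; exact: subsetUl.
Qed.

End Oracle.

(* [clock st v = level * k + i], where [i] is the next matroid [v] asks. *)
Record state (V : finType) (k : nat) := State {
  owner : V -> option 'I_k;
  clock : V -> nat
}.

(** * States, their levels and their potential *)

Section State.
Variables (V : finType) (k : nat).
Implicit Types (st : state V k) (u v : V) (i j : 'I_k) (t D L : nat).

Definition level st v := clock st v %/ k.

Definition covered st := [set v | isSome (owner st v)].

Definition upper st i t :=
  [set u | (owner st u == Some i) && (t <= level st u)].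

Definition place st v i :=
  State [eta owner st with v |-> Some i] (clock st).

Definition evict st u := State [eta owner st with u |-> None] (clock st).

Definition tick st v :=
  State (owner st) [eta clock st with v |-> (clock st v).+1].

Lemma upper_place st v i j t : owner st v = None ->
  upper (place st v i) j t =
    if (j == i) && (t <= level st v) then v |: upper st j t else upper st j t.
Proof.
move=> ov; apply/setP => x; case: ifP => cond; rewrite !inE /level /=;
  case: (eqVneq x v) => // ->; rewrite ov (inj_eq Some_inj) eq_sym ?cond //.
Qed.

Lemma upper_evict st u i t : upper (evict st u) i t = upper st i t :\ u.
Proof. by apply/setP => x; rewrite !inE /level /=; case: (eqVneq x u). Qed.

Lemma upper_tick st v i t : owner st v = None ->
  upper (tick st v) i t = upper st i t.
Proof.
move=> ov; apply/setP => x; rewrite !inE /level /=.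
by case: (eqVneq x v) => // ->; rewrite ov.
Qed.

Lemma upperS st i t t' : t <= t' -> upper st i t' \subset upper st i t.
Proof.
by move=> le; apply/subsetP => x; rewrite !inE => /andP[-> /(leq_trans le)].
Qed.

Definition ticks st := \sum_v clock st v.
Definition height st := \sum_(v | owner st v) (level st v).+1.
(** A negative answer costs one query and adds one tick. If [L] bounds the length of a binary
    search, an insertion or swap costs at most [L.+1] queries and adds one to [height]. *)
Definition potential L st := ticks st + L.+1 * height st.

Lemma height_place st v i : owner st v = None ->
  height (place st v i) = (level st v).+1 + height st.
Proof.
move=> ov; rewrite /height (bigD1 v) /= ?eqxx //; congr (_ + _).
apply: eq_bigl => x; case: (eqVneq x v) => [->|_] /=; first by rewrite ov.
by rewrite andbT.
Qed.

Lemma height_evict st u : owner st u ->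
  height st = (level st u).+1 + height (evict st u).
Proof.
move=> ou; rewrite /height (bigD1 u) //=; congr (_ + _).
by apply: eq_bigl => x; case: (eqVneq x u); rewrite ?andbF ?andbT.
Qed.

Lemma height_tick st v : owner st v = None -> height (tick st v) = height st.
Proof.
move=> ov; apply: eq_bigr => x /= ox; rewrite /level /=.
by case: eqP => // xv; rewrite xv ov in ox.
Qed.

Lemma ticks_tick st v : ticks (tick st v) = (ticks st).+1.
Proof.
rewrite /ticks (bigD1 v) //= [in RHS](bigD1 v) //= eqxx addSn.
by congr (_ + _).+1; apply: eq_bigr => x /negPf ->.
Qed.

Lemma card_upper st t : \sum_i #|upper st i t| =
  #|[set v in covered st | t <= level st v]|.
Proof.
under eq_bigr => i _ do rewrite -sum1dep_card.
rewrite (exchange_big_dep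
  (fun v => (owner st v : bool) && (t <= level st v))) /=.
  rewrite -sum1dep_card; apply: eq_big => [v|v /andP[]]; first by rewrite !inE.
  case ov: (owner st v) => [i|//] _ tv; rewrite (big_pred1 i) // => j.
  by rewrite tv andbT (inj_eq Some_inj) eq_sym.
by move=> i v _ /andP[/eqP-> ->].
Qed.

Definition final D st := [forall v, owner st v || (k * D <= clock st v)].

End State.

(** * The rounds, their invariant and their cost *)

Section Algorithm.
Variables (V : finType) (k : nat).
Implicit Types (st : state V k) (u v : V) (i j : 'I_k) (t D L : nat).

(** Picking a pair, instead of computing [i] from the clock, gives an element of ['I_k] without a
    proof that [k] is positive. *)
Definition step D st : oracle_alg V k (state V k) :=
  if [pick x : V * 'I_k | [&& owner st x.1 == None, clock st x.1 < k * D
                            & x.2 == clock st x.1 %% k :> nat]] is Some (v, i)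
  then
    let X := v |: upper st i (level st v) in
    Query i X (fun b =>
      if ~~ b then Return V k (tick st v)
      else if level st v is t.+1 then
        let s := enum [set u in upper st i t | level st u == t] in
        bind (bsearch v i (up_log 2 (size s)) X s)
             (fun u => Return V k (place (evict st u) v i))
      else Return V k (place st v i))
  else Return V k st.

Fixpoint run D n st : oracle_alg V k (state V k) :=
  if n is n'.+1 then bind (run D n' st) (step D) else Return V k st.

Variable M : 'I_k -> matroid V.

(** In the last clause, [t * k + i < clock st v] means that [v] has already passed matroid [i] at
    level [t]. *)
Definition valid D st :=
  [/\ forall i, indep (M i) (upper st i 0),
      forall v, clock st v <= k * D,
      forall v, owner st v -> clock st v < k * D
    & forall v i t, t * k + i < clock st v -> spanned (M i) (upper st i t) v].

Lemma indep_upper D st i t : valid D st -> indep (M i) (upper st i t).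
Proof. by case=> iU _ _ _; apply: indepS (iU i); exact: upperS. Qed.

Lemma partitionable_covered D st : valid D st -> partitionable M (covered st).
Proof.
case=> iU _ _ _; apply/existsP; exists [ffun i => upper st i 0].
apply/and3P; split.
- apply/'forall_forallP => i j; apply/implyP => ij; rewrite !ffunE.
  rewrite -setI_eq0; apply/eqP/setP => x; rewrite !inE !andbT.
  apply/negP => /andP[/eqP-> /eqP[ji]].
  by rewrite ji eqxx in ij.
- apply/eqP/setP => x; rewrite inE; apply/bigcupP/idP => [[i _]|].
    by rewrite ffunE !inE => /andP[/eqP->].
  case ox: (owner st x) => [i|//] _.
  by exists i => //; rewrite ffunE !inE ox eqxx.
- by apply/forallP => i; rewrite ffunE.
Qed.

Lemma card_covered D st : valid D st -> #|covered st| <= max_partitionable M.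
Proof. by move=> /partitionable_covered; exact: leq_bigmax_cond. Qed.

Lemma level_leq D st v : valid D st -> level st v <= D.
Proof.
case=> _ le _ _; rewrite /level; move: (clock st v) (le v) => c lec.
case: (posnP k) => [->|k0]; first by rewrite divn0.
by have := leq_div2r k lec; rewrite mulKn.
Qed.

(** A covered element has level below [D], so it adds at most [D] to [height]. *)
Lemma potential_leq D L st : valid D st ->
  potential L st <= #|V| * (k * D) + L.+1 * (max_partitionable M * D).
Proof.
move=> vst; have [_ le lt _] := vst; apply: leq_add.
  by rewrite /ticks -sum_nat_const; exact: leq_sum.
rewrite leq_mul2l; apply/orP; right.
apply: leq_trans (leq_mul (card_covered vst) (leqnn D)).
rewrite /height -sum_nat_const.
rewrite (eq_bigl (fun v => v \in covered st)); last first.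
  by move=> v; rewrite inE.
apply: leq_sum => v; rewrite inE => ov; rewrite /level ltn_divLR; last first.
  by have := leq_ltn_trans (leq0n _) (lt v ov); rewrite muln_gt0 => /andP[].
by rewrite mulnC lt.
Qed.

Lemma valid_tick D st v i : owner st v = None -> clock st v < k * D ->
    i = clock st v %% k :> nat ->
    ~~ indep (M i) (v |: upper st i (level st v)) ->
  valid D st -> valid D (tick st v).
Proof.
move=> ov cv iE dv [iU le lt sp]; split.
- by move=> j; rewrite upper_tick.
- by move=> x /=; case: eqP => // ->.
- by move=> x /= ox; case: eqP => [xv|_]; [rewrite xv ov in ox | exact: lt].
move=> x j t /=; rewrite upper_tick //; case: eqP => [->|_]; last exact: sp.
(* The only new instance of the last clause is the matroid and level just asked. *)
rewrite ltnS leq_eqVlt => /orP[/eqP E|]; last exact: sp.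
have k0 : 0 < k := leq_ltn_trans (leq0n _) (ltn_ord j).
have tE : t = level st v by rewrite /level -E divnMDl ?divn_small ?addn0.
have ij : j = i by apply: val_inj; rewrite /= iE -E modnMDl modn_small.
by rewrite ij tE /spanned dv orbT.
Qed.

Lemma valid_place D st v i : owner st v = None -> clock st v < k * D ->
    indep (M i) (v |: upper st i 0) ->
  valid D st -> valid D (place st v i).
Proof.
move=> ov cv iv [iU le lt sp]; split=> //=.
- by move=> j; rewrite upper_place //; case: eqP => [->|].
- by move=> x; case: eqP => [->|_] //; exact: lt.
move=> x j t /sp; apply: spannedS; rewrite upper_place //.
by case: ifP => // _; exact: subsetUr.
Qed.

(* Swapping [u] out of and [v] into block [i] only enlarges the spans of the
   sets [upper st i t]: for [t <= level st u] the element [v] was already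
   spanned by [upper st i t], and for larger [t] no element is lost. *)
Lemma valid_swap D st u v i : owner st u = Some i -> owner st v = None ->
    clock st v < k * D -> level st v = (level st u).+1 ->
    indep (M i) (v |: upper st i 0 :\ u) ->
  valid D st -> valid D (place (evict st u) v i).
Proof.
move=> ou ov cv lvu iuv vst; have [iU le lt sp] := vst.
have ov' : owner (evict st u) v = None by rewrite /=; case: eqP.
have vU t : v \notin upper st i t by rewrite inE ov.
have U j t : upper (place (evict st u) v i) j t =
    if (j == i) && (t <= level st v) then v |: upper st j t :\ u
    else upper st j t :\ u by rewrite upper_place // upper_evict.
split=> //.
- move=> j; rewrite U andbT; case: eqP => [->//|_].
  by apply: indepS (iU j); exact: subsetDl.
- by move=> x /=; case: eqP => [->|_] //; case: eqP => // _; exact: lt.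
move=> x j t /(sp x j t); rewrite U; case: (eqVneq j i) => [->|ji] /=.
  case: (leqP t (level st u)) => tu.
    rewrite (leq_trans tu) ?lvu //; apply: spanned_exchange.
    - exact: (indep_upper _ _ vst).
    - by rewrite inE ou eqxx.
    have := sp v i (level st u) _; rewrite {1}/spanned (negPf (vU _)) /=.
    (* [v] is one level above [u], so it has passed matroid [i] at the level of [u]. *)
    have cE : level st u * k + i < clock st v.
      have := leq_trunc_div (clock st v) k; rewrite -/(level st v) lvu mulSn.
      by apply: leq_trans; rewrite addnC ltn_add2r.
    move=> /(_ cE); apply: contra; apply: indepS; apply: setUS; exact: upperS.
  apply: spannedS; have E : upper st i t :\ u = upper st i t.
    apply/setP => y; rewrite !inE; case: (eqVneq y u) => //= ->.
    by rewrite leqNgt tu andbF.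
  by rewrite E; case: ifP => // _; exact: subsetUr.
apply: spannedS; apply/subsetP => y; rewrite !inE; case: (eqVneq y u) => //= ->.
by rewrite ou (inj_eq Some_inj) eq_sym (negPf ji).
Qed.

Lemma step_final D st : final D st -> step D st = Return V k st.
Proof.
move=> /forallP fst; rewrite /step.
case: pickP => // -[v i] /and3P[/eqP ov cv _].
by have := fst v; rewrite ov leqNgt cv.
Qed.

(** Growth of the potential pays for every query, and a round from a non-final state asks at least
    one. *)
Lemma step_spec D L st : valid D st -> up_log 2 (max_partitionable M) <= L ->
    ~~ final D st ->
  let st' := output (step D st) M in
  [/\ valid D st', 0 < num_queries (step D st) M
    & num_queries (step D st) M + potential L st <= potential L st'].
Proof.
move=> vst leL /forallPn[v0 /norP[ov0 cv0]] /=; rewrite -ltnNge in cv0.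
have k0 : 0 < k.
  by have := leq_ltn_trans (leq0n _) cv0; rewrite muln_gt0 => /andP[].
rewrite /step; case: pickP => [[v i]|]; last first.
  move=> /(_ (v0, Ordinal (ltn_pmod (clock st v0) k0))).
  by rewrite /= cv0 eqxx; case: (owner st v0) ov0.
move=> /and3P[/= /eqP ov cv /eqP iE] {v0 ov0 cv0}.
case: ifP => /= [dv|/negbFE iv].
  split=> //; first exact: valid_tick cv iE dv vst.
  by rewrite /potential ticks_tick height_tick.
case lv: (level st v) => [|t] /=.
  rewrite lv in iv; split=> //; first exact: valid_place.
  by rewrite /potential height_place // -[ticks (place _ _ _)]/(ticks st); lia.
set s := enum _; have [_ _ _ sp] := vst.
have vU r : v \notin upper st i r by rewrite inE ov.
have Es : upper st i t = upper st i t.+1 :|: [set x in s].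
  apply/setP => x; rewrite !inE mem_enum !inE; lia.
(* [v] passed matroid [i] at level [t] before reaching [t.+1]; with [iv] this gives the invariant of
   the binary search. *)
have dv : ~~ indep (M i) (v |: upper st i t).
  have := sp v i t _; rewrite /spanned (negPf (vU t)) /=; apply.
  have := leq_trunc_div (clock st v) k; rewrite -/(level st v) lv mulSn.
  by apply: leq_trans; rewrite addnC ltn_add2r.
rewrite lv in iv.
have [|us [Y [XY YX iY dY]]] :=
  output_bsearch v (up_logP (size s) (ltnSn 1)) iv.
  by rewrite -setUA -Es.
rewrite output_bind num_queries_bind num_queries_bsearch /= addn0.
set u := output _ _ in us dY *.
move: us; rewrite mem_enum !inE => /andP[/andP[/eqP ou _] /eqP lu].
split=> //.
  apply: valid_swap => //; first by rewrite lv lu.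
  apply: (@indep_exchange _ _ _ Y) => //.
  - exact: (indep_upper _ _ vst).
  - by rewrite inE ou eqxx.
  - by apply: (subsetP XY); rewrite !inE eqxx.
  - apply: subset_trans YX _; rewrite -setUA -Es; apply: setUS; exact: upperS.
(* The candidates are covered, so the search is logarithmic in [max_partitionable M] and not merely
   in [#|V|]. *)
have sL : up_log 2 (size s) <= L.
  apply: leq_trans leL; apply: leq_up_log; apply: leq_trans (card_covered vst).
  rewrite -cardE subset_leq_card //; apply/subsetP => x.
  by rewrite !inE => /andP[/andP[/eqP->]].
have ov' : owner (evict st u) v = None by rewrite /=; case: eqP.
(* [v] adds [t.+2] to [height] and [u] takes away [t.+1]; the net gain of one pays for [L.+1]
   queries. *)
rewrite /potential height_place // (height_evict (u := u)) ?ou //.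
rewrite -[ticks (place _ _ _)]/(ticks st) -[level (evict st u) v]/(level st v).
rewrite lv lu; nia.
Qed.

(** The last conclusion forces a final state once [n] exceeds every possible potential. *)
Lemma run_spec D L n st : valid D st -> up_log 2 (max_partitionable M) <= L ->
  let st' := output (run D n st) M in
  [/\ valid D st',
      num_queries (run D n st) M + potential L st <= potential L st'
    & final D st' || (n + potential L st <= potential L st')].
Proof.
move=> vst leL /=; elim: n => [|n [vst' nq fin]] /=.
  by rewrite leqnn orbT.
rewrite output_bind num_queries_bind; move: vst' nq fin.
set st' := output _ M => vst' nq fin.
have [f'|nf'] := boolP (final D st').
  by rewrite step_final //= f' addn0.
rewrite (negPf nf') /= in fin; have [v2 q0 pot] := step_spec vst' leL nf'.
split=> //; first lia.
by apply/orP; right; lia.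
Qed.

(* The elements of level above [t], together with the uncovered ones, are
   spanned in the [i]-th matroid by [upper st i t], so a partitionable set
   has at most as many of them as [covered st] has elements of level at
   least [t]. *)
Lemma max_partitionable_leq D st t : valid D st -> final D st -> t < D ->
  max_partitionable M <=
  #|covered st| + #|[set v in covered st | level st v == t]|.
Proof.
move=> vst /forallP fst tD; have [iU le lt sp] := vst.
apply/bigmax_leqP => T /existsP[P /and3P[_ /eqP<- /forallP iP]].
have [k0|k0] := posnP k.
  by rewrite big1 ?cards0 // => i; have := ltn_ord i; lia.
pose A := [set v | t < level st v].
have tk_lt v i : v \in A -> t * k + i < clock st v.
  rewrite inE /level leq_divRL // mulSn => /(leq_trans _); apply.
  by rewrite addnC ltn_add2r.
have PA i : #|P i :&: A| <= #|upper st i t|.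
  apply: (@indep_spanned_leq _ (M i)); first exact: (indep_upper _ _ vst).
    by apply: indepS (iP i); exact: subsetIl.
  by move=> v /setIP[_ /(tk_lt v i)]; exact: sp.
(* In a final state an uncovered element has level at least [D], hence lies in [A]. *)
have cA : ~: A \subset [set v in covered st | level st v <= t].
  apply/subsetP => v; rewrite !inE -leqNgt => vt; rewrite vt andbT.
  have := fst v; case: (owner st v) => //= kD.
  have := leq_div2r k kD; rewrite mulKn // -/(level st v) => Dv.
  by have := leq_trans tD (leq_trans Dv vt); rewrite ltnn.
have : \bigcup_i P i \subset ~: A :|: \bigcup_i (P i :&: A).
  apply/bigcupsP => i _; apply/subsetP => v vP; rewrite inE in_setC.
  case: (boolP (v \in A)) => //= vA; apply/bigcupP; exists i => //.
  by rewrite inE vP.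
move=> /subset_leq_card/leq_trans; apply.
apply: leq_trans (leq_card_setU _ _) _.
apply: (@leq_trans (#|[set v in covered st | level st v <= t]| +
                    #|[set v in covered st | t <= level st v]|)).
  apply: leq_add; first exact: subset_leq_card.
  rewrite -card_upper;
  apply: (@leq_trans (\sum_i #|P i :&: A|)); last exact: leq_sum.
  elim/big_rec2: _ => [|i m B _ IH]; first by rewrite cards0.
  by apply: leq_trans (leq_card_setU _ _) _; rewrite leq_add2l.
(* The union of the two sets lies in [covered st], and their intersection consists of covered
   elements of level exactly [t]. *)
rewrite -cardsUI; apply: leq_add; apply: subset_leq_card; apply/subsetP => v.
  by rewrite !inE => /orP[/andP[]|/andP[]].
by rewrite !inE eqn_leq => /andP[/andP[-> ->] /andP[_ ->]].
Qed.


End Algorithm.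

(** * The complete algorithm *)

Definition init (V : finType) (k : nat) : state V k :=
  State (fun=> None) (fun=> 0).

(* The number of rounds exceeds the bound of [potential_leq] with
   [max_partitionable M] replaced by [#|V|], hence the final potential. *)
Definition partition_alg (D : nat) (V : finType) (k : nat) :
    oracle_alg V k {set V} :=
  bind (run D (#|V| * (k * D) + (up_log 2 #|V|).+1 * (#|V| * D)).+1 (init V k))
       (fun st => Return V k (covered st)).

Lemma valid_init D (V : finType) k (M : 'I_k -> matroid V) :
  valid M D (init V k).
Proof.
split=> //= i; suff -> : upper (init V k) i 0 = set0 by exact: indep0.
by apply/setP => x; rewrite !inE.
Qed.

(** The value [p] is unknown to the decision tree; [up_log 2 p] enters only the analysis, as the
    weight [L] of the potential. *)
Lemma partition_alg_spec D (V : finType) k (M : 'I_k -> matroid V) :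
  let p := max_partitionable M in
  let S := output (partition_alg D V k) M in
  [/\ num_queries (partition_alg D V k) M <=
        #|V| * (k * D) + (up_log 2 p).+1 * (p * D),
      partitionable M S, #|S| <= p & D * p <= D * #|S| + #|S|].
Proof.
rewrite /partition_alg; set N := (_ + _ * (#|V| * D)).+1.
rewrite output_bind num_queries_bind addn0.
set p := max_partitionable M.
have [vst nq] := run_spec N (valid_init D M) (leqnn (up_log 2 p)).
set st := output _ M in vst nq * => fin.
have pot := potential_leq (up_log 2 p) vst.
have pV : p <= #|V| by apply/bigmax_leqP => T _; exact: max_card.
have ltN : #|V| * (k * D) + (up_log 2 p).+1 * (p * D) < N.
  by rewrite ltnS leq_add2l leq_mul ?leq_mul2r ?pV ?orbT // ltnS leq_up_log.
have {}fin : final D st.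
  by case/orP: fin => // leN; move: ltN; rewrite ltnNge (leq_trans _ pot) //
    (leq_trans _ leN) // leq_addr.
split; [exact: leq_trans (leq_addr _ _) (leq_trans nq pot)
       | exact: partitionable_covered vst | exact: card_covered vst |].
(* [max_partitionable_leq] is summed over all [t < D]; each covered element has one level, so it is
   counted at most once in the second term. *)
have sumD c : D * c = \sum_(t < D) c by rewrite sum_nat_const card_ord.
rewrite !sumD.
apply: (@leq_trans (\sum_(t < D)
    (#|covered st| + #|[set v in covered st | level st v == t]|))).
  by apply: leq_sum => t _; exact: max_partitionable_leq vst fin (ltn_ord t).
rewrite big_split leq_add2l /=.
under eq_bigr => t _ do rewrite -sum1dep_card big_mkcondr.
rewrite exchange_big -sum1_card; apply: leq_sum => v _ /=.
rewrite -big_mkcond; case: (ltnP (level st v) D) => lD.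
  by rewrite (big_pred1 (Ordinal lD)).
by rewrite big_pred0 // => t; apply/negbTE; rewrite gtn_eqF // (leq_trans _ lD).
Qed.

(** * Real estimates and the choice of [D] *)

Local Open Scope ring_scope.

(** If [up_log 2 p] is [l.+1], then [2 ^ l < p], and [ln 2] is at least one half. *)
Lemma up_log2_leq_ln (R : realType) (p : nat) : (0 < p)%N ->
  (up_log 2 p)%:R <= 1 + 2 * ln (p%:R : R).
Proof.
case: p => [|[|p]] // _; first by rewrite up_log1 ln1 mulr0 addr0 ler01.
set q := p.+2; have := @up_log_gtn 2 q (ltnSn 1) isT.
have : (0 < up_log 2 q)%N by rewrite up_log_gt0.
case: (up_log 2 q) => //= l _ lt_q.
(* This is [ln (1 + x) <= x] at [x = - 1 / 2]. *)
have ln2 : 1 / 2 <= ln (2 : R).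
  have := @le_ln1Dx R (- 2^-1); rewrite ltrN2 invf_lt1 // => /(_ _).
  have -> : 1 + - 2^-1 = 2^-1 :> R by lra.
  by rewrite lnV ?posrE // => /(_ _); lra.
have : (l%:R : R) * ln 2 <= ln q%:R.
  rewrite mulr_natl -lnXn // -natrX.
  by rewrite ler_ln ?posrE ?ltr0n ?expn_gt0 // ler_nat ltnW.
have := ler0n R l; rewrite -natr1; nra.
Qed.

Theorem theorem5 (R : realType) :
  exists C : R, 0 < C /\
  forall eps : R, 0 < eps ->
  exists A : forall (V : finType) (k : nat), oracle_alg V k {set V},
  forall (V : finType) (n k : nat) (M : 'I_k -> matroid V),
  #|V| = n ->
  let p := max_partitionable M in
  let S := output (A V k) M in
  [/\ (num_queries (A V k) M)%:R
        <= C * ((k%:R * n%:R + p%:R * ln p%:R) * eps^-1),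
      partitionable M S
    & (1 - eps) * p%:R <= #|S|%:R].
Proof.
(* A factor 2 comes from [D <= 2 / eps], a factor 3 from absorbing [2 * p] into [k * n]. *)
exists 6; split=> // eps eps0.
(* Doubling makes up for rounding down: [D] is at least [eps^-1] when [eps <= 1]. For larger [eps],
   [D] is 0 and the required size is not positive. *)
exists (partition_alg (2 * Num.truncn eps^-1)) => V n k M Vn p S.
set D := (2 * _)%N.
have e0 : 0 <= eps^-1 by rewrite invr_ge0 ltW.
have De : D%:R <= 2 * eps^-1 by rewrite natrM ler_pM2l // truncn_le.
have eD : eps <= 1 -> 1 <= D%:R * eps.
  move=> eps1; have lt1 : (0 < Num.truncn eps^-1)%N.
    by rewrite truncn_gt0 invf_ge1.
  rewrite -ler_pdivrMr // mul1r; apply: ltW.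
  apply: lt_le_trans (truncnS_gt _) _.
  by rewrite ler_nat /D mul2n -addnn -addn1 leq_add2l.
have [nq pS Sp DpS] := partition_alg_spec D M.
rewrite -/S -/p in nq pS Sp DpS; clearbody S D.
split=> //; last first.
  have [eps1|/eD De1] := ltP 1 eps.
    by apply: le_trans (ler0n _ _); rewrite mulr_le0_ge0 // subr_le0 ltW.
  have : (D * p)%:R <= (D * #|S| + #|S|)%:R :> R by rewrite ler_nat.
  rewrite natrD !natrM; have : #|S|%:R <= p%:R :> R by rewrite ler_nat.
  have := ler0n R p; move: De1.
  move: (D%:R) (p%:R) (#|S|%:R) => d q s de q0 sq dq.
  (* Multiplying by [eps] gives [q - s <= d * eps * (q - s) <= eps * q]. *)
  have dqs : d * (q - s) <= q by lra.
  have := ler_wpM2r (ltW eps0) dqs.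
  have := ler_wpM2r (_ : 0 <= q - s) de; rewrite subr_ge0 => /(_ sq); nra.
have pkn : (p <= k * n)%N.
  apply/bigmax_leqP => T /existsP[P /and3P[_ /eqP<- _]].
  rewrite -[in (k * n)%N](card_ord k) -sum_nat_const.
  elim/big_rec2: _ => [|i m B _ IH]; first by rewrite cards0.
  by apply: leq_trans (leq_card_setU _ _) _; rewrite leq_add // -Vn max_card.
have pL : p%:R * (up_log 2 p).+1%:R <= 2 * p%:R + 2 * (p%:R * ln p%:R) :> R.
  case: (posnP p) => [->|p0]; first by rewrite !mul0r !mulr0 addr0.
  have := ler_wpM2l (ler0n R p) (@up_log2_leq_ln R p p0); rewrite -natr1; lra.
have plnp : 0 <= p%:R * ln p%:R :> R.
  case: (posnP p) => [->|p0]; first by rewrite mul0r.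
  by rewrite mulr_ge0 // ln_ge0 // ler1n.
apply: (@le_trans _ _ (D%:R * (k%:R * n%:R + p%:R * (up_log 2 p).+1%:R))).
  by rewrite -!natrM -natrD -natrM ler_nat (leq_trans nq) // Vn;
    apply: eq_leq; ring.
have pkn' : p%:R <= k%:R * n%:R :> R by rewrite -natrM ler_nat.
apply: (@le_trans _ _ (D%:R * (3 * (k%:R * n%:R + p%:R * ln p%:R)))).
  by apply: ler_wpM2l => //; lra.
have -> : 6 * ((k%:R * n%:R + p%:R * ln p%:R) * eps^-1) =
   2 * eps^-1 * (3 * (k%:R * n%:R + p%:R * ln p%:R)) by ring.
by apply: ler_wpM2r => //; have := ler0n R p; lra.
Qed.
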